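(* $\max\{\mathfrak b,\mathfrak s,\mathrm{cov}(\mathcal N)\}\le\mathsf{\Delta}\le\mathsf{\Sigma}\le\mathrm{non}(\mathcal M)$.
   Context: $[\omega]^\omega$ is the family of all infinite subsets of $\omega$, and $S_\omega$ is the group of all bijections of $\omega$. For $f,g\in\omega^\omega$, $f\le^* g$ means that $\{n\in\omega:f(n)\not\le g(n)\}$ is finite; for sets $a,b$, $a\subseteq^* b$ means that $a\setminus b$ is finite. Define $$\mathsf{\Delta}=\min\{|H|:H\subseteq S_\omega\ \wedge\ \forall A\in[\omega]^\omega\ \exists h\in H\ \ \{a\in A:a\ne h(a)\in A\}\in[\omega]^\omega\},$$ $$\mathsf{\Sigma}=\min\{|H|:H\subseteq S_\omega\ \wedge\ \forall A,B\in[\omega]^\omega\ \exists h\in H\ \ h[A]\cap B\in[\omega]^\omega\}.$$ $\mathfrak b=\min\{|B|:B\subseteq\omega^\omega,\ \forall f\in\omega^\omega\,\exists g\in B\ g\not\le^* f\}$; $\mathfrak s=\min\{|S|:S\subseteq[\omega]^\omega,\ \forall a\in[\omega]^\omega\,\exists s\in S\ (a\not\subseteq^* s\wedge a\not\subseteq^*\omega\setminus s)\}$. $\mathcal M$ and $\mathcal N$ are the $\sigma$-ideals of meager sets and of Lebesgue null sets in the real line; $\mathrm{cov}(\mathcal N)$ is the smallest cardinality of a subfamily of $\mathcal N$ whose union is $\mathbb R$; $\mathrm{non}(\mathcal M)$ is the smallest cardinality of a subset of $\mathbb R$ not in $\mathcal M$. *)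

(* Defs.v *)
From HB Require Import structures.
From mathcomp Require Import all_boot all_order all_algebra.
From mathcomp Require Import all_classical all_reals all_analysis.
Import numFieldNormedType.Exports.
Set Implicit Arguments.
Unset Strict Implicit.
Unset Printing Implicit Defensive.

Local Open Scope classical_set_scope.
Local Open Scope card_scope.

(* A cardinal number is the class of all types equipotent to a given set.  It
   is an arrow type and not [set Type], because the universe of [Type] here
   has to be as large as the (monomorphic) universe below [set]. *)
Definition cardinal := Type -> Prop.

Definition cardinal_of T (A : set T) : cardinal := fun X => [set: X] #= A.

Definition cardinal_le (k l : cardinal) : Prop :=
  exists X Y, [/\ k X, l Y & [set: X] #<= [set: Y]].

Definition cardinal_max (k l : cardinal) : cardinal :=
  if `[< cardinal_le k l >] then l else k.

(* min {|H| : P H}, i.e. the cardinality of an H of least size satisfying P.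
   If P held for no H, this would be the empty class, which is not in relation
   cardinal_le with anything; cardinal_minP covers the other case. *)
Definition cardinal_min T (P : set (set T)) : cardinal := fun X =>
  exists H, [/\ P H, forall K, P K -> H #<= K & cardinal_of H X].

Lemma cardinal_leE T U (A : set T) (B : set U) :
  cardinal_le (cardinal_of A) (cardinal_of B) <-> A #<= B.
Proof.
split=> [[X [Y [XA YB XY]]]|AB].
  have {}XA : [set: X] #= A := XA; have {}YB : [set: Y] #= B := YB.
  by rewrite -(card_le_eql XA) -(card_le_eqr YB).
exists (set_type A), (set_type B); split; [exact: card_setT | exact: card_setT |].
by rewrite (card_le_eql (card_setT A)) (card_le_eqr (card_setT B)).
Qed.

Lemma card_le_rel T U (A : set T) (B : set U) (r : T -> U -> Prop) :
    (forall x, A x -> exists2 y, B y & r x y) ->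
    (forall x x' y, A x -> A x' -> r x y -> r x' y -> x = x') ->
  A #<= B.
Proof.
move=> rtot rinj.
have /choice[f fr] : forall x : A, exists y : B, r (val x) (val y).
  move=> x; have [y By rxy] := rtot _ (set_valP x).
  by exists (SigSub (mem_set By)).
apply/card_leP/injfunPex; exists f => // x x' _ _ e.
apply/val_inj/(rinj _ _ (val (f x))); [exact: set_valP| exact: set_valP|by []|].
by rewrite e.
Qed.

Lemma card_least T (P : set (set T)) : P !=set0 ->
  exists2 H, P H & forall K, P K -> H #<= K.
Proof.
move=> [H0 PH0].
have [H0e|/set0P[x0 _]] := eqVneq H0 set0.
  exists H0 => // K _; rewrite H0e; exact: card_ge0.
pose good (Z : set (set T -> T)) :=
  (forall f H, Z f -> P H -> H (f H)) /\
  (forall f g H, Z f -> Z g -> P H -> f H = g H -> f = g).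
have [F Fgood Ftot|Z [[ZP Zinj] Zmax]] := @Zorn_bigcup _ good.
  split=> [f H [Z FZ Zf] PH|f g H [Z FZ Zf] [Z' FZ' Zg] PH e].
    have [mem _] := Fgood _ FZ; exact: mem Zf PH.
  case: (Ftot _ _ FZ FZ') => sub.
    have [_ inj] := Fgood _ FZ'; exact: inj (sub _ Zf) Zg PH e.
  have [_ inj] := Fgood _ FZ; exact: inj Zf (sub _ Zg) PH e.
have [[H PH Hsurj]|nH] := pselect
    (exists2 H, P H & forall x, H x -> exists2 f, Z f & f H = x).
  exists H => // K PK.
  apply: (@card_le_rel _ _ _ _ (fun x y => exists f, [/\ Z f, f H = x & f K = y])).
    move=> x /Hsurj[f Zf fx]; exists (f K); first exact: ZP Zf PK.
    by exists f.
  move=> x x' y _ _ [f [Zf <- fy]] [g [Zg <- gy]].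
  by rewrite (Zinj f g K) // fy gy.
have /choice[h hP] : forall H, exists x, P H -> H x /\ forall f, Z f -> f H <> x.
  move=> H; have [PH|] := pselect (P H); last by exists x0.
  apply: contrapT => nx; apply: nH; exists H => // x Hx.
  apply: contrapT => nf; apply: nx; exists x => _; split=> // f Zf fx.
  by apply: nf; exists f.
have Zh : ~ Z h by move=> Zh; have [_ /(_ _ Zh)] := hP _ PH0.
exfalso; apply: (Zmax (Z `|` [set h])).
  split; first by left.
  by move=> /(_ h (or_intror erefl)).
split=> [f H [Zf|->] PH|f g H [Zf|->] [Zg|->] PH //].
- exact: ZP Zf PH.
- by have [] := hP _ PH.
- by move=> e; exact: Zinj Zf Zg PH e.
- by move=> e; have [_ /(_ _ Zf)] := hP _ PH.
- by move=> e; have [_ /(_ _ Zg)] := hP _ PH; rewrite e.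
Qed.

Lemma cardinal_minP T (P : set (set T)) : P !=set0 ->
  exists H, [/\ P H, forall K, P K -> H #<= K &
    forall X, cardinal_min P X <-> cardinal_of H X].
Proof.
move=> /card_least[H PH Hmin]; exists H; split=> // X; split; last by exists H.
move=> [K [PK Kmin XK]]; apply/card_eqPle.
rewrite (card_le_eql XK) (card_le_eqr XK); split; [exact: Kmin|exact: Hmin].
Qed.

Definition infinite_subsets : set (set nat) := [set A | infinite_set A].

Definition Sym_omega : set (nat -> nat) := [set h | bijective h].

Definition le_star (f g : nat -> nat) : Prop :=
  finite_set [set n | ~ (f n <= g n)%N].

Definition subset_star (a b : set nat) : Prop := finite_set (a `\` b).

Definition Delta : cardinal := cardinal_min [set H : set (nat -> nat) |
  H `<=` Sym_omega /\
  forall A, infinite_subsets A ->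
    exists2 h, H h & infinite_subsets [set a | [/\ A a, a <> h a & A (h a)]]].

Definition Sigma : cardinal := cardinal_min [set H : set (nat -> nat) |
  H `<=` Sym_omega /\
  forall A B, infinite_subsets A -> infinite_subsets B ->
    exists2 h, H h & infinite_subsets ((h @` A) `&` B)].

Definition bounding_number : cardinal :=
  cardinal_min [set B : set (nat -> nat) |
    forall f : nat -> nat, exists2 g, B g & ~ le_star g f].

Definition splitting_number : cardinal :=
  cardinal_min [set S : set (set nat) |
    S `<=` infinite_subsets /\
    forall a, infinite_subsets a ->
      exists2 s, S s & ~ subset_star a s /\ ~ subset_star a (~` s)].

Definition nowhere_dense (T : topologicalType) (A : set T) : Prop :=
  interior (closure A) = set0.

Definition meager (T : topologicalType) (A : set T) : Prop :=
  exists2 F : nat -> set T, forall n, nowhere_dense (F n) & A = \bigcup_n F n.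

Definition meager_ideal (R : realType) : set (set R) := [set A | meager A].

Definition null_ideal (R : realType) : set (set R) :=
  [set A | lebesgue_measure.-negligible A].

Arguments meager_ideal R : clear implicits.
Arguments null_ideal R : clear implicits.

Definition cov T (I : set (set T)) : cardinal :=
  cardinal_min [set F : set (set T) | F `<=` I /\ \bigcup_(A in F) A = setT].

Definition non T (I : set (set T)) : cardinal :=
  cardinal_min [set A : set T | ~ I A].

(* Main.v *)
Require Import Defs.
From mathcomp Require Import all_boot all_order all_algebra.
From mathcomp Require Import all_classical all_reals all_analysis.
From mathcomp Require Import zify lra.
Import Order.TTheory GRing.Theory Num.Theory numFieldNormedType.Exports.

(** Each inequality between two minima is obtained by turning a family
    admissible for the larger cardinal into one, of at most the same size, that
    is admissible for the smaller cardinal ([cardinal_min_le]).  Below, [H] is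
    a family of permutations admissible for Delta.

    Bounding number: attach to every [h] in [H] a function bounding both [h]
    and its inverse.  A function [f] dominating all of these would be defeated
    by a set [A] with gaps larger than [f], since no [h] could move infinitely
    many points of [A] inside [A] ([Delta_family_unbounded]).

    Splitting number: the graph of a permutation can be coloured greedily with
    three colours, and the colour classes of all [h] in [H] form a splitting
    family: an unsplit infinite set would lie almost inside one class of every
    [h] ([Delta_family_splitting]).  That these countably many sets per
    permutation are no more numerous than [H] itself is the rule that an
    infinite cardinal absorbs a countable factor ([infinite_card_setX_nat]);
    [H] is infinite because unbounded families are.

    Covering number of the null ideal: choose a random set [A] by picking one
    point in each of a sequence of intervals of natural numbers whose lengths
    grow so fast that, given [h], the point picked in the [m]-th interval is
    the image or the preimage under [h] of a point of an earlier interval with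
    probability at most a constant times [2 ^- m].  By the Borel-Cantelli lemma,
    [h] almost surely moves only finitely many points of [A] inside [A].  The
    exceptional null sets, one for each [h], must cover the line
    ([Delta_family_null_cover]).

    Delta is at most Sigma because a permutation sending infinitely many points
    of one half of [A] into a disjoint half moves them inside [A]
    ([Sigma_family_Delta]).

    Sigma is at most the least size of a nonmeager set because a generic
    permutation sends infinitely many points of [A] into [B].  The line is
    mapped into the involutions in such a way that this happens outside a
    meager set of reals ([meager_generic_involution]); a nonmeager set of reals
    then yields sufficiently many involutions. *)

Set Implicit Arguments.
Unset Strict Implicit.
Unset Printing Implicit Defensive.

Local Open Scope classical_set_scope.
Local Open Scope card_scope.

(** * Cardinals and infinite sets *)

Lemma cardinal_min_le T U (P : set (set T)) (Q : set (set U)) :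
    Q !=set0 -> (forall H, Q H -> exists2 K, P K & K #<= H) ->
  cardinal_le (cardinal_min P) (cardinal_min Q).
Proof.
move=> Q0 PQ; have [H [QH _ Hmin]] := cardinal_minP Q0.
have [K PK KH] := PQ _ QH.
have [L [PL Lmin LP]] : exists L, [/\ P L, forall K, P K -> L #<= K &
    forall X, cardinal_min P X <-> cardinal_of L X].
  by apply: cardinal_minP; exists K.
have [X [Y [LX HY XY]]] : cardinal_le (cardinal_of L) (cardinal_of H).
  by apply/cardinal_leE; apply: card_le_trans KH; exact: Lmin.
by exists X, Y; split => //; [exact/LP|exact/Hmin].
Qed.

Lemma cardinal_max_le (k l m : cardinal) :
  cardinal_le k m -> cardinal_le l m -> cardinal_le (cardinal_max k l) m.
Proof. by rewrite /cardinal_max; case: ifP. Qed.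

Lemma infinite_natP (A : set nat) :
  infinite_set A <-> forall n, exists2 a, A a & (n <= a)%N.
Proof.
split=> [Ainf n|Aunb /finite_seqP[s As]].
  apply: contrapT => nA; apply: Ainf; apply: sub_finite_set (finite_II n) => a Aa.
  by rewrite /= ltnNge; apply/negP => na; apply: nA; exists a.
have [a Aa] := Aunb (\max_(i <- s) i).+1.
by rewrite ltnNge => /negP; apply; apply: leq_bigmax_seq => //; move: Aa; rewrite As.
Qed.

Lemma infinite_enum T (A : set T) : infinite_set A ->
  exists2 e : nat -> T, injective e & forall n, A (e n).
Proof.
move=> /infiniteP/card_leP/injfunPex[f _ finj].
exists (fun n => val (f (SigSub (mem_set (I : [set: nat] n))))) => [m n /val_inj|n].
  by move=> /finj; rewrite !inE => /(_ I I)[].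
exact: set_valP.
Qed.

(** A maximal family [Z] of disjoint copies of the natural numbers inside [A]
    leaves out only finitely many points, or it could be enlarged.  Each copy
    [e] absorbs its own product with the natural numbers along its even
    places; the odd places of one fixed copy take up the points left out. *)
Lemma infinite_card_setX_nat T (A : set T) :
  infinite_set A -> A `*` [set: nat] #<= A.
Proof.
move=> Ainf.
pose good (Z : set (nat -> T)) :=
  (forall e, Z e -> injective e /\ forall n, A (e n)) /\
  (forall e f m n, Z e -> Z f -> e m = f n -> e = f).
have [F Fgood Ftot|Z [[ZA Zdisj] Zmax]] := @Zorn_bigcup _ good.
  split=> [e [Y FY Ye]|e f m n [Y FY Ye] [Y' FY' Yf] ef].
    by have [+ _] := Fgood _ FY; apply.
  have [YY'|Y'Y] := Ftot _ _ FY FY'.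
    by have [_] := Fgood _ FY'; apply; [exact: YY'|exact: Yf|exact: ef].
  by have [_] := Fgood _ FY; apply; [exact: Ye|exact: Y'Y|exact: ef].
pose rest := [set x | A x /\ forall e n, Z e -> e n <> x].
have rest_fin : finite_set rest.
  apply: contrapT => /infinite_enum[e einj erest].
  apply: (Zmax (Z `|` [set e])).
    split; first by left.
    by move=> /(_ e (or_intror erefl)) Ze; have [_ /(_ e 0%N Ze)] := erest 0%N.
  split=> [f [/ZA//|->]|f g m n [Zf|->] [Zg|->] // efg].
  - by split=> // n; have [] := erest n.
  - exact: Zdisj efg.
  - by have [_ /(_ _ m Zf)] := erest n.
  - by have [_ /(_ _ n Zg)] := erest m; rewrite efg.
have [e0 Ze0] : Z !=set0.
  apply: contrapT => nZ; apply: Ainf; apply: sub_finite_set rest_fin => x Ax.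
  by split=> // e n Ze; case: nZ; exists e.
have [i iinj] : exists i : T -> nat, {in rest &, injective i}.
  exact/countable_injP/finite_set_countable.
(* [i] numbers the points left out and [e0] is the copy that takes them up. *)
pose r (xk : T * nat) y :=
  (exists e n, [/\ Z e, xk.1 = e n & y = e (pickle (n, xk.2)).*2]) \/
  (rest xk.1 /\ y = e0 (pickle (i xk.1, xk.2)).*2.+1).
apply: (@card_le_rel _ _ _ _ r).
  move=> [x k] [Ax _] /=.
  have [[e [n [Ze xe]]]|nZ] := pselect (exists e n, Z e /\ x = e n).
    exists (e (pickle (n, k)).*2); first by have [_] := ZA _ Ze; apply.
    by left; exists e, n.
  exists (e0 (pickle (i x, k)).*2.+1); first by have [_] := ZA _ Ze0; apply.
  right; split=> //; split=> // e n Ze ex; apply: nZ.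
  by exists e, n.
have halves (f g : nat -> T) m n : Z f -> Z g -> f m = g n -> f = g /\ m = n.
  move=> Zf Zg fg; have E := Zdisj _ _ _ _ Zf Zg fg; split=> //; subst g.
  by have [+ _] := ZA _ Zf; apply.
move=> [x k] [x' k'] y _ _.
case=> [[e [n [Ze /= -> ->]]]|[/= restx ->]];
  case=> [[e' [n' [Ze' /= -> /halves]]]|[/= restx' /halves]].
- by move=> /(_ Ze Ze')[-> /double_inj/(pcan_inj pickleK)[-> ->]].
- by move=> /(_ Ze Ze0)[_]; lia.
- by move=> /(_ Ze0 Ze')[_]; lia.
- move=> /(_ Ze0 Ze0)[_ []] /double_inj/(pcan_inj pickleK)[/iinj].
  by rewrite !inE => /(_ restx restx') -> ->.
Qed.

(** * The families whose least sizes are compared *)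

Definition Delta_family (H : set (nat -> nat)) :=
  H `<=` Sym_omega /\
  forall A, infinite_subsets A ->
    exists2 h, H h & infinite_subsets [set a | [/\ A a, a <> h a & A (h a)]].

Definition Sigma_family (H : set (nat -> nat)) :=
  H `<=` Sym_omega /\
  forall A B, infinite_subsets A -> infinite_subsets B ->
    exists2 h, H h & infinite_subsets ((h @` A) `&` B).

Definition unbounded_family (B : set (nat -> nat)) :=
  forall f : nat -> nat, exists2 g, B g & ~ le_star g f.

Definition splitting_family (S : set (set nat)) :=
  S `<=` infinite_subsets /\
  forall a, infinite_subsets a ->
    exists2 s, S s & ~ subset_star a s /\ ~ subset_star a (~` s).

(** Two disjoint infinite halves of [A]: a permutation carrying infinitely many
    points of one half into the other moves all of them. *)
Lemma Sigma_family_Delta H : Sigma_family H -> Delta_family H.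
Proof.
move=> [Hsym HS]; split=> // A /infinite_enum[e einj eA].
have sub_inf (f : nat -> nat) : injective f -> infinite_subsets (range (e \o f)).
  move=> finj; apply/infiniteP; apply: (@card_le_rel _ _ _ _ (fun n x => x = e (f n))).
    by move=> n _; exists (e (f n)) => //; exists n.
  by move=> m n x _ _ -> /einj/finj.
have [|n m [/double_inj]|h Hh hinf] := HS _ _ (sub_inf double _) (sub_inf (S \o double) _) => //.
  exact: double_inj.
exists h => // fin; apply: hinf; apply: sub_finite_set (finite_image h fin).
move=> _ [[_ [m _ <-] <-]] [n _ /= hn]; exists (e m.*2) => //=.
by rewrite -hn; split=> // /einj; lia.
Qed.

(** * Unbounded families *)

Lemma sparse_set (f : nat -> nat) : exists2 A, infinite_subsets A &
  forall a b, A a -> A b -> (a < b)%N -> (f a < b)%N.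
Proof.
pose e n := iter n (fun a => (maxn a (f a)).+1) 0%N.
have eS n : (e n < e n.+1)%N /\ (f (e n) < e n.+1)%N.
  by rewrite /= !ltnS leq_maxl leq_maxr.
have emono : {homo e : m n / (m <= n)%N >-> (m <= n)%N}.
  by apply: homo_leq => [//|//|n]; [exact: leq_trans|have [/ltnW] := eS n].
exists (range e).
  apply/infinite_natP => n; exists (e n); first by exists n.
  by elim: n => // n IH; apply: leq_ltn_trans IH _; have [] := eS n.
move=> _ _ [m _ <-] [n _ <-] mn; have [_ fm] := eS m.
apply: leq_trans fm (emono _ _ _).
by rewrite ltnNge; apply: contraL mn => /emono; rewrite leqNgt.
Qed.

Lemma unbounded_infinite B : unbounded_family B -> infinite_set B.
Proof.
move=> Bunb /finite_seqP[s Bs].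
have [g + []] := Bunb (fun n => \max_(f <- s) f n).
rewrite Bs /= => gs; apply: sub_finite_set (finite_set0 nat) => n; apply => /=.
exact: (@leq_bigmax_seq _ _ xpredT (fun f => f n)).
Qed.

(** Attach to [h] a function [g] bounding [h] and its inverse.  If a single [f]
    dominated all these [g], a set [A] whose gaps outgrow [f] would contain both
    [a] and [h a], distinct, only finitely often: the larger of the two exceeds
    [f] at the smaller one, whereas [g] at the smaller one bounds it. *)
Lemma Delta_family_unbounded H : Delta_family H ->
  exists2 B, unbounded_family B & B #<= H.
Proof.
move=> [Hsym HD].
have /choice[G GP] : forall h : nat -> nat, exists g : nat -> nat, Sym_omega h ->
    forall n, (h n <= g n)%N /\ (n <= g (h n))%N.
  move=> h; have [[h' hK h'K]|nb] := pselect (Sym_omega h); last by exists id.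
  exists (fun n => h n + h' n)%N => _ n; rewrite hK; lia.
exists (G @` H); last exact: card_image_le.
move=> f; have [A Ainf Af] := sparse_set f.
have [h Hh hinf] := HD _ Ainf.
exists (G h) => [|fin]; first by exists h.
have {}GP := GP h (Hsym _ Hh).
apply: hinf; set X := [set a | _].
have : finite_set ([set n | ~ (G h n <= f n)%N] `|` h @^-1` [set n | ~ (G h n <= f n)%N]).
  rewrite finite_setU; split=> //; apply: finite_preimage => // m n _ _.
  by have [h' hK _] := Hsym _ Hh; exact: (can_inj hK).
apply: sub_finite_set => a [Aa ne Aha] /=.
have [hge ainv] := GP a.
case: (ltngtP a (h a)) => [lt|gt|//]; [left|right] => le.
  by have := Af _ _ Aa Aha lt; lia.
by have := Af _ _ Aha Aa gt; lia.
Qed.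

Lemma Delta_family_infinite H : Delta_family H -> infinite_set H.
Proof.
move=> /Delta_family_unbounded[B /unbounded_infinite Binf BH] Hfin.
exact: Binf (card_le_finite BH Hfin).
Qed.

(** * Splitting families *)

(** [F n] may consult the values below [n] only: at and beyond [n] it is shown
    the dummy value [d]. *)
Lemma course_of_values_recursion (F : nat -> (nat -> nat) -> nat) d :
  exists c : nat -> nat, forall n, c n = F n (fun i => if (i < n)%N then c i else d).
Proof.
pose t := fix t n := if n is m.+1 then fun i => if i == m then F m (t m) else t m i
                     else fun=> d.
exists (fun n => t n.+1 n) => n; rewrite /= eqxx; congr F; apply/funext => i.
elim: n => [//|n IH] /=; rewrite ltnS; case: (ltngtP i n) IH => [//|//|->] _.
by rewrite eqxx.
Qed.

Definition mex2 (a b : nat) : nat :=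
  if 0%N \notin [:: a; b] then 0 else if 1%N \notin [:: a; b] then 1 else 2.

Lemma mex2_lt3 a b : (mex2 a b < 3)%N.
Proof. by rewrite /mex2; do 2?case: ifP. Qed.

Lemma mex2_neq a b : mex2 a b <> a /\ mex2 a b <> b.
Proof. by move: a b => [|[|a]] [|[|b]]. Qed.

(** Colour greedily along the natural order: [n] has at most two smaller
    neighbours, among [h n] and the preimage of [n]. *)
Lemma permutation_3_colouring (h : nat -> nat) : bijective h ->
  exists c : nat -> nat, forall n, (c n < 3)%N /\ (n <> h n -> c n <> c (h n)).
Proof.
move=> [h' hK h'K].
(* The dummy value 3 is not a colour, so that later neighbours exclude none. *)
have [c cE] := course_of_values_recursion (fun n c => mex2 (c (h n)) (c (h' n))) 3.
exists c => n; split; first by rewrite cE mex2_lt3.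
move=> ne; case: (ltngtP n (h n)) => // lt.
  rewrite [c (h n)]cE hK lt => ce.
  by have [_ /(_ (esym ce))] := mex2_neq (if (h (h n) < h n)%N then c (h (h n)) else 3%N) (c n).
rewrite [c n]cE lt => ce.
by have [/(_ ce)] := mex2_neq (c (h n)) (if (h' n < n)%N then c (h' n) else 3%N).
Qed.

(** The colour classes of the members of [H] split: a set that none of them
    splits has almost all its points in one class of each [h], and is then
    almost free of pairs [a], [h a] of different colours. *)
Lemma Delta_family_splitting H : Delta_family H ->
  exists2 S, splitting_family S & S #<= H.
Proof.
move=> DH; have [Hsym HD] := DH.
have /choice[C CP] : forall h : nat -> nat, exists c : nat -> nat, Sym_omega h ->
    forall n, (c n < 3)%N /\ (n <> h n -> c n <> c (h n)).
  move=> h; have [/permutation_3_colouring[c cP]|nb] := pselect (Sym_omega h).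
    by exists c.
  by exists id.
pose cls (hk : (nat -> nat) * nat) := [set n | C hk.1 n = hk.2].
exists ((cls @` (H `*` setT)) `&` infinite_subsets); last first.
  apply: card_le_trans (infinite_card_setX_nat (Delta_family_infinite DH)).
  apply: card_le_trans (card_image_le cls _).
  by apply: subset_card_le => s [].
split=> [s []//|a ainf].
have [h Hh hinf] := HD _ ainf.
have {}CP := CP h (Hsym _ Hh).
apply: contrapT => nsplit.
(* If [a] were almost inside the class, [h] would move almost no point of [a]
   inside [a]; so [a] is almost disjoint from each of the three classes. *)
have one_class k : finite_set (a `&` cls (h, k)).
  have [fin|inf] := pselect (finite_set (cls (h, k))).
    exact: finite_setIr.
  apply: contrapT => meet; apply: nsplit; exists (cls (h, k)).
    by split=> //; exists (h, k).
  split; last by rewrite /subset_star setDE setCK.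
  move=> fin; apply: hinf.
  have : finite_set ((a `\` cls (h, k)) `|` h @^-1` (a `\` cls (h, k))).
    rewrite finite_setU; split=> //; apply: finite_preimage => // m n _ _.
    by have [h' hK _] := Hsym _ Hh; exact: (can_inj hK).
  apply: sub_finite_set => n [an ne ahn]; have [_ /(_ ne) cne] := CP n.
  have [ck|nck] := pselect (C h n = k); last by left; split.
  by right; split=> //= ck'; apply: cne; rewrite ck ck'.
apply: ainf; have := bigcup_finite (finite_II 3) (fun k _ => one_class k).
apply: sub_finite_set => n an; exists (C h n) => //=.
by have [] := CP n.
Qed.

(** * Generic permutations *)

(** The involution exchanging [n] and [s n] whenever [s] itself does. *)
Definition involution_of (s : nat -> nat) n := if s (s n) == n then s n else n.

Lemma involution_ofK s : involutive (involution_of s).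
Proof.
move=> n; rewrite /involution_of; case: (eqVneq (s (s n)) n) => [e|/negPf ->//].
by rewrite !e eqxx.
Qed.

Lemma involution_of_swap s a b : s a = b -> s b = a -> involution_of s a = b.
Proof. by move=> sa sb; rewrite /involution_of sa sb eqxx. Qed.

(** A one-to-one numbering of pairs that exceeds the first entry, so that the
    bits read by [first_one b n] move to infinity with [n]. *)
Definition pair_code n m := (2 ^ n * m.*2.+1)%N.

Lemma ltn_pair_code n m : (n < pair_code n m)%N.
Proof. by rewrite (leq_trans (ltn_expl n (ltnSn 1)))// leq_pmulr. Qed.

Lemma leq_pair_code n m m' : (m <= m')%N -> (pair_code n m <= pair_code n m')%N.
Proof. by move=> mm'; rewrite leq_mul2l ltnS leq_double mm' orbT. Qed.

Lemma pair_code_inj n m n' m' :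
  pair_code n m = pair_code n' m' -> n = n' /\ m = m'.
Proof.
move=> e; have logE k l : logn 2 (pair_code k l) = k.
  rewrite lognM ?expn_gt0// pfactorK// lognE /= dvdn2 /= odd_double /=.
  by rewrite addn0.
have nn' : n = n' by rewrite -(logE n m) e logE.
split=> //; move: e; rewrite nn' /pair_code => /eqP; rewrite eqn_mul2l expn_eq0 /=.
by rewrite eqSS => /eqP/double_inj.
Qed.

(** Decodes a sequence of bits into a sequence of natural numbers, which takes
    a prescribed value at [n] as soon as finitely many bits beyond [n] do. *)
Definition first_one (b : nat -> bool) n : nat :=
  xget 0 [set m | b (pair_code n m) /\ forall i, (i < m)%N -> ~~ b (pair_code n i)].

Lemma first_oneE (b : nat -> bool) n m : b (pair_code n m) ->
  (forall i, (i < m)%N -> ~~ b (pair_code n i)) -> first_one b n = m.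
Proof.
move=> bm bi; apply: xget_unique => //= m' [bm' bi'].
by case: (ltngtP m' m) => // lt; [have := bi _ lt; rewrite bm'|have := bi' _ lt; rewrite bm].
Qed.

Local Open Scope ring_scope.

Definition bit (R : realType) (x : R) k : bool := odd `|Num.floor (2 ^+ k * x)|%N.

Definition generic_involution (R : realType) (x : R) : nat -> nat :=
  involution_of (first_one (bit x)).

(** Halving a dyadic interval: the two halves are told apart by the next bit. *)
Lemma floor_dyadicS (R : realType) (x : R) k (j : int) (b : bool) :
  Num.floor (2 ^+ k.+1 * x) = 2 * j + b%:Z ->
  Num.floor (2 ^+ k * x) = j /\ bit x k.+1 = b.
Proof.
move=> e; split; last by rewrite /bit e; case: (b); lia.
apply: floor_def; have := floor_itv (2 ^+ k.+1 * x).
rewrite e exprS -mulrA !intrD !intrM /=.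
have : 0 <= (b%:Z%:~R : R) <= 1 by case: (b); rewrite ?lexx ler01.
by move: (b%:Z%:~R : R) (2 ^+ k * x) => c y; lra.
Qed.

(** The bits after the [k]-th are free on every dyadic interval of length
    [2 ^- k]: halve it repeatedly, keeping each time the half on which the new
    bit is the prescribed one. *)
Lemma dyadic_prescribe_bits (R : realType) (p : nat -> bool) k (j : int) N :
  (k <= N)%N -> exists j' : int, forall x : R, Num.floor (2 ^+ N * x) = j' ->
    Num.floor (2 ^+ k * x) = j /\ forall i, (k < i <= N)%N -> bit x i = p i.
Proof.
elim: N => [|N IH].
  by rewrite leqn0 => /eqP->; exists j => x ->; split=> // i; lia.
rewrite leq_eqVlt => /predU1P[->|].
  by exists j => x ->; split=> // i; lia.
rewrite ltnS => /IH[j' j'P]; exists (2 * j' + (p N.+1)%:Z) => x.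
move=> /floor_dyadicS[/j'P[-> ix] bx]; split=> // i /andP[ki].
by rewrite leq_eqVlt => /predU1P[->//|iN]; apply: ix; rewrite ki.
Qed.

(** Dyadic intervals may replace open sets because each has interior points and
    every open set contains one. *)
Lemma dyadic_nowhere_dense (R : realType) (A : set R) :
    (forall k j, exists N j', forall x : R, Num.floor (2 ^+ N * x) = j' ->
      Num.floor (2 ^+ k * x) = j /\ ~ A x) ->
  nowhere_dense A.
Proof.
move=> Adyadic; rewrite /nowhere_dense -subset0 => x.
rewrite /interior /= => /nbhs_ballP[e /= e0 xe].
have [k ke] : exists k, 2 ^- k < e.
  exists (Num.bound e^-1); rewrite -[ltRHS]invrK ltf_pV2 ?posrE ?invr_gt0 ?exprn_gt0//.
  exact: upper_nthrootP.
have [N [j' NA]] := Adyadic k (Num.floor (2 ^+ k * x)).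
have N0 : (0 : R) < 2 ^+ N by rewrite exprn_gt0.
(* The midpoint of the dyadic interval of number [j']. *)
pose y : R := 2 ^- N * (j'%:~R + 2^-1).
have nbhs_floor : nbhs y [set z | Num.floor (2 ^+ N * z) = j'].
  apply/nbhs_ballP; exists (2 ^- N * 2^-1) => [|z]; first by rewrite /= mulr_gt0 ?invr_gt0.
  rewrite /ball /= -(ltr_pM2l N0) mulrA divff ?gt_eqF// mul1r.
  rewrite -[X in X * `|_|](gtr0_norm N0) -normrM mulrBr /y mulrA divff ?gt_eqF// mul1r.
  move=> /ltr_normlP[yz zy]; apply: floor_def; rewrite intrD.
  by move: yz zy; move: (_ * z) => u; lra.
have yx : ball x e y.
  have [+ _] := NA _ (nbhs_singleton nbhs_floor).
  have := floor_itv (2 ^+ k * x); have := floor_itv (2 ^+ k * y).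
  move=> + + floor_eq; rewrite floor_eq intrD => yk xk.
  have K0 : (0 : R) < 2 ^+ k by rewrite exprn_gt0.
  apply: lt_trans ke; rewrite -(ltr_pM2l K0) divff ?gt_eqF//.
  rewrite -[X in X * `|_|](gtr0_norm K0) -normrM mulrBr.
  apply/ltr_normlP; move: yk xk.
  by move: (_ * x) (_ * y) => u v yk xk; split; lra.
have [z [Az]] := xe _ yx _ nbhs_floor.
by move=> /NA[_]; apply.
Qed.

Lemma meager_sub_bigcup (T : topologicalType) (A : set T) (F : nat -> set T) :
  (forall n, nowhere_dense (F n)) -> A `<=` \bigcup_n F n -> meager A.
Proof.
move=> Fnd AF; exists (fun n => A `&` F n); last first.
  by rewrite -setI_bigcupr; apply/seteqP; split=> x; [move=> Ax; split=> //; exact: AF|case].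
move=> n; rewrite /nowhere_dense -subset0 -(Fnd n).
by apply: interiorS; apply: closure_subset; apply: subIsetr.
Qed.

Lemma meager_setT (R : realType) : ~ meager [set: R].
Proof.
move=> [F Fnd FT].
have /Baire Fdense : forall n, open (~` closure (F n)) /\ dense (~` closure (F n)).
  move=> n; split; first by rewrite openC; exact: closed_closure.
  apply: contrapT => /denseNE[V [[x [Vo Vx]] VF]].
  suff : set0 x by [].
  rewrite -(Fnd n); suff : V `<=` (closure (F n))° by apply.
  rewrite -open_subsetE//.
  by move=> y Vy; apply: contrapT => nFy; have : set0 y by rewrite -VF.
have [|x [_ Fx]] := Fdense setT _ openT; first by exists 0.
have : [set: R] x by [].
rewrite FT => -[n _ Fnx]; apply: (Fx n I); exact: subset_closure.
Qed.

(** On any dyadic interval of length [2 ^- k], pick [a] in [A] and [b] in [B]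
    beyond [n] and [k]: the requirement that the decoded sequence maps [a] to
    [b] and [b] to [a] prescribes only finitely many bits after the [k]-th, so
    it holds on a smaller dyadic interval, where the involution sends [a] to
    [b].  Hence the set [Z n] of the points where no exchange occurs beyond [n]
    is nowhere dense. *)
Lemma meager_generic_involution (R : realType) (A B : set nat) :
  infinite_subsets A -> infinite_subsets B ->
  meager [set x : R | ~ infinite_subsets ((generic_involution x @` A) `&` B)].
Proof.
move=> /infinite_natP Ainf /infinite_natP Binf.
pose Z n := [set x : R | forall a b, A a -> B b -> (n <= a)%N -> (n <= b)%N ->
  first_one (bit x) a = b -> first_one (bit x) b <> a].
apply: (@meager_sub_bigcup _ _ Z) => [n|x /= nx].
  apply: dyadic_nowhere_dense => k j.
  have [a Aa na] := Ainf (maxn n k); have [b Bb nb] := Binf (maxn n k).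
  (* Zeros at all the codes read before [pair_code a b] and [pair_code b a]. *)
  have [j' j'P] := @dyadic_prescribe_bits R
    (fun i => (i == pair_code a b) || (i == pair_code b a)) k j
    (maxn (pair_code a b) (pair_code b a)) ltac:(have := ltn_pair_code a b; lia).
  exists (maxn (pair_code a b) (pair_code b a)), j' => x /j'P[-> xbits]; split=> //.
  have first a' b' : (a', b') = (a, b) \/ (a', b') = (b, a) ->
      first_one (bit x) a' = b'.
    move=> ab; apply: first_oneE => [|i ib].
      rewrite xbits; first by case: ab => -[-> ->]; rewrite eqxx ?orbT.
      by have := ltn_pair_code a' b'; case: ab => -[-> ->]; lia.
    rewrite xbits; last first.
      have := ltn_pair_code a' i; have := leq_pair_code a' (ltnW ib).
      by case: ab => -[-> ->]; lia.
    by apply/negP => /orP[] /eqP/pair_code_inj[]; case: ab ib => -[-> ->]; lia.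
  move=> xZ; apply: (xZ a b Aa Bb).
  - exact: leq_trans (leq_maxl _ _) na.
  - exact: leq_trans (leq_maxl _ _) nb.
  - by apply: first; left.
  - by apply: first; right.
apply: contrapT => nZ; apply: nx; apply/infinite_natP => n.
apply: contrapT => nfound; apply: nZ; exists n => // a b Aa Bb na nb sa sb.
apply: nfound; exists b => //; split=> //; exists a => //.
exact: involution_of_swap.
Qed.

Lemma nonmeager_Sigma_family (R : realType) (X : set R) : ~ meager X ->
  exists2 H, Sigma_family H & H #<= X.
Proof.
move=> Xnm; exists ((fun x => generic_involution x) @` X); last exact: card_image_le.
split=> [_ [x _ <-]|A B Ainf Binf]; first exact/inv_bij/involution_ofK.
apply: contrapT => nH; apply: Xnm.
have [F Fnd FE] := meager_generic_involution R Ainf Binf.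
apply: (meager_sub_bigcup Fnd) => x Xx; rewrite -FE /= => inf.
by apply: nH; exists (generic_involution x) => //; exists x.
Qed.

(** * Random sparse sets *)

(** The [m]-th block of natural numbers starts here.  It is long enough to give
    different addresses to the [2 * m * block_scale m] cells of length
    [(block_scale m)^-1] into which the interval from [-m] to [m] is cut. *)
Fixpoint block_start m : nat :=
  if m is p.+1 then (block_start p + (2 * p * (2 ^ p * (block_start p).+1)).+1)%N else 0%N.

(** Larger than [2 ^ m] times the number of addresses of smaller levels, which
    makes the probabilities of collisions summable. *)
Definition block_scale m := (2 ^ m * (block_start m).+1)%N.

(** The set of the [address x m] for all [m] is a random set, sparse enough
    that a given permutation almost never moves infinitely many of its points
    inside it.  The remainder changes nothing when [`|x| < m]; it keeps the
    address inside the [m]-th block for every [x]. *)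
Definition address (R : realType) (x : R) m : nat :=
  (block_start m +
   `|Num.floor ((block_scale m)%:R * (x + m%:R))| %% (2 * m * block_scale m).+1)%N.

(** When [`|x| < m], the points [x] whose address is [w] lie in this interval. *)
Definition cell (R : realType) m w : set R :=
  `[(w - block_start m)%:R / (block_scale m)%:R - m%:R,
    (w - block_start m).+1%:R / (block_scale m)%:R - m%:R].

Lemma block_start_addressS (R : realType) (x : R) m :
  (block_start m <= address x m < block_start m.+1)%N.
Proof. by rewrite leq_addr /= ltn_add2l ltn_pmod. Qed.

Lemma block_start_homo : {homo block_start : m n / (m <= n)%N}.
Proof. by apply: homo_leq => [//|//|n]; [exact: leq_trans|exact: leq_addr]. Qed.

Lemma leq_block_start n : (n <= block_start n)%N.
Proof. by elim: n => //= n IH; lia. Qed.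

Lemma address_lt_block (R : realType) (x : R) m n :
  (m < n)%N -> (address x m < block_start n)%N.
Proof.
by move=> /block_start_homo; have /andP[_] := block_start_addressS x m; exact: leq_trans.
Qed.

Lemma block_scale_gt0 m : (0 < block_scale m)%N.
Proof. by rewrite muln_gt0 expn_gt0. Qed.

Lemma address_cell (R : realType) (x : R) m : `|x| < m%:R -> cell m (address x m) x.
Proof.
move=> /ltr_normlP[x1 x2].
have N0 : (0 : R) < (block_scale m)%:R by rewrite ltr0n block_scale_gt0.
rewrite /cell /address addKn /=.
set y := (block_scale m)%:R * (x + m%:R).
have y0 : 0 <= y by rewrite mulr_ge0//; lra.
have ylt : y < (2 * m * block_scale m)%:R.
  by rewrite (natrM _ (2 * m)) [ltRHS]mulrC ltr_pM2l// natrM; lra.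
have /andP[] := floor_itv y.
have : (0 <= Num.floor y)%R by rewrite floor_ge0.
case: (Num.floor y) => // f _ /= fy yf.
rewrite modn_small; last first.
  by rewrite ltnS ltnW// -(ltr_nat R) (le_lt_trans _ ylt)//.
rewrite in_itv /= lerBlDr lerBrDr ler_pdivrMr// ler_pdivlMr// ![_ * (block_scale _)%:R]mulrC.
by apply/andP; split; [exact: fy|rewrite -addn1; exact: ltW].
Qed.

Section collisions.
Context {R : realType}.
Notation mu := (@lebesgue_measure R).

Lemma measurable_cell m w : measurable (@cell R m w).
Proof. exact: measurable_itv. Qed.

Lemma measure_cell m w : (mu (cell m w) = ((block_scale m)%:R^-1)%:E)%E.
Proof.
have N0 : (0 : R) < (block_scale m)%:R by rewrite ltr0n block_scale_gt0.
rewrite lebesgue_measure_itv /= lte_fin ltrD2r ltr_pM2r ?invr_gt0// ltr_nat ltnSn.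
by rewrite -EFinD; congr EFin; rewrite -[_.+1]addn1 natrD; lra.
Qed.

(** The points whose address of level [m] may be matched, by [h] or by its
    inverse [h'], with an address of a smaller level. *)
Definition collision (h h' : nat -> nat) m : set R :=
  \big[setU/set0]_(v < block_start m) (cell m (h v) `|` cell m (h' v)).

Lemma measurable_collision h h' m : measurable (collision h h' m).
Proof.
by apply: bigsetU_measurable => v _; apply: measurableU; exact: measurable_cell.
Qed.

Lemma measure_collision h h' m : (mu (collision h h' m) <= (4 / (2 ^ m.+1)%:R)%:E)%E.
Proof.
pose c := (block_scale m)%:R^-1 : R.
have cm v : (mu (cell m (h v) `|` cell m (h' v)) <= (c + c)%:E)%E.
  have cell_le w : (mu (cell m w) <= c%:E)%E by rewrite measure_cell.
  apply: le_trans (measureU2 mu (measurable_cell m _) (measurable_cell m _)) _.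
  by rewrite EFinD; exact: leeD (cell_le _) (cell_le _).
apply: le_trans (Boole_inequality (A := fun v => cell m (h v) `|` cell m (h' v)) mu _) _.
  by move=> v _; apply: measurableU; exact: measurable_cell.
apply: (@le_trans _ _ (\sum_(v < block_start m) (c + c)%:E)%E).
  by apply: lee_sum => v _; exact: cm.
rewrite sumEFin lee_fin sumr_const card_ord -[leLHS]mulr_natl /c /block_scale.
rewrite expnS !natrM invfM -[(block_start m).+1]addn1 natrD.
have : (0 : R) <= (block_start m)%:R by [].
have : (0 : R) < (2 ^ m)%:R by rewrite ltr0n expn_gt0.
move: ((2 ^ m)%:R : R) ((block_start m)%:R : R) => p k p0 k0.
have pp : p * p^-1 = 1 by rewrite divff ?gt_eqF.
have kk : k * (k + 1)^-1 <= 1 by rewrite ler_pdivrMr; lra.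
rewrite ler_pdivlMr; last by lra.
move: (p^-1) ((k + 1)^-1) pp kk => q r pp kk.
have -> : k * (q * r + q * r) * (2 * p) = 4 * (k * r) * (p * q) by lra.
by rewrite pp; lra.
Qed.

Lemma negligible_collisions h h' : mu.-negligible (lim_sup_set (collision h h')).
Proof.
exists (lim_sup_set (collision h h')); split => //.
  by apply: bigcapT_measurable => n; apply: bigcup_measurable => m _; exact: measurable_collision.
apply: lim_sup_set_cvg0 => [n|]; first exact: measurable_collision.
apply: le_lt_trans (lee_nneseries _ (fun n _ => measure_collision h h' n)) _ => //.
by apply: le_lt_trans (epsilon_trick0 xpredT _) _; rewrite ?ltry.
Qed.

End collisions.

(** For a point [x] outside the null set of [h], and for addresses [a] and [h a]
    of levels [i <> j], the larger level is one at which [x] collides unless it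
    is below a fixed bound [n1].  So [h] moves only finitely many addresses of
    [x] to other addresses of [x], and the set of all addresses witnesses that
    some other [h] in [H] has [x] in its null set. *)
Lemma Delta_family_null_cover (R : realType) H : Delta_family H ->
  exists2 F : set (set R),
    F `<=` null_ideal R /\ \bigcup_(A in F) A = setT & F #<= H.
Proof.
move=> [Hsym HD].
have /choice[inv invP] : forall h : nat -> nat, exists h', Sym_omega h -> cancel h h'.
  by move=> h; have [[h' hK _]|nb] := pselect (Sym_omega h); [exists h'|exists id].
pose null h : set R := lim_sup_set (collision h (inv h)).
exists (null @` H); last exact: card_image_le.
split=> [_ [h _ <-]|]; first exact: negligible_collisions.
rewrite -subTset => x _.
have Ainf : infinite_subsets (range (address x)).
  apply/infinite_natP => n; exists (address x n); first by exists n.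
  by have /andP[+ _] := block_start_addressS x n; apply: leq_trans; exact: leq_block_start.
have [h Hh hinf] := HD _ Ainf.
exists (null h); first by exists h.
move=> n _; apply: contrapT => ncoll; apply: hinf.
pose n1 := maxn n (Num.bound `|x|).
have xcell m : (n1 <= m)%N -> cell m (address x m) x.
  move=> n1m; apply: address_cell; apply: lt_le_trans (archi_boundP _) _ => //.
  by rewrite ler_nat; apply: leq_trans n1m; exact: leq_maxr.
have miss m v : (n1 <= m)%N -> (v < block_start m)%N ->
    ~ (cell m (h v) x \/ cell m (inv h v) x).
  move=> n1m vm cx; apply: ncoll; exists m => /=; first lia.
  by rewrite /collision -(bigcup_mkord _ (fun v => cell m (h v) `|` cell m (inv h v))); exists v.
apply: sub_finite_set (finite_II (block_start n1)) => a [[i _ <-] ne [j _ hj]] /=.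
have [ij|ji|ij] := ltngtP i j; last by case: ne; rewrite -hj ij.
  have [n1j|/(ltn_trans ij)] := leqP n1 j; last exact: address_lt_block.
  by case: (miss j _ n1j (address_lt_block x ij)); left; rewrite -hj; exact: xcell.
have [n1i|] := leqP n1 i; last exact: address_lt_block.
case: (miss i _ n1i (address_lt_block x ji)); right.
by rewrite hj (invP _ (Hsym _ Hh)); exact: xcell.
Qed.

Theorem theorem3p2 (R : realType) :
  [/\ cardinal_le
        (cardinal_max bounding_number
           (cardinal_max splitting_number (cov (null_ideal R))))
        Delta,
      cardinal_le Delta Sigma &
      cardinal_le Sigma (non (meager_ideal R))].
Proof.
have nonempty : ~ meager_ideal R setT := @meager_setT R.
have [H0 SH0 _] := nonmeager_Sigma_family nonempty.
have DH0 := Sigma_family_Delta SH0.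
split.
- apply: cardinal_max_le; last apply: cardinal_max_le.
  + by apply: cardinal_min_le; [exists H0|exact: Delta_family_unbounded].
  + by apply: cardinal_min_le; [exists H0|exact: Delta_family_splitting].
  + by apply: cardinal_min_le; [exists H0|exact: Delta_family_null_cover].
- apply: cardinal_min_le; first by exists H0.
  by move=> H SH; exists H; [exact: Sigma_family_Delta|exact: card_lexx].
- by apply: cardinal_min_le; [exists setT|exact: nonmeager_Sigma_family].
Qed.
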